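(* Let $n\geq 3$ be odd. Let $P_0\cdots P_{n-1}$ be a polygon in $\mathbb{RP}^2$ such that no three consecutive vertices (in the cyclic order) are collinear, and let $O$ be any point not lying on any of the edges of the polygon, i.e. on any of the lines $P_iP_{i+1}$ (indices modulo $n$). Then the centrally-projective billiard $\mathrm{CPol}(O;P_0,\ldots,P_{n-1})$ is $2n$-reflective.
   Context: All objects live in the real projective plane $\mathbb{RP}^2$ (containing $\mathbb{R}^2$ as an affine chart). Projective reflection law: let $p$ be a point and let $T\neq L$ be two lines through $p$ ($T$ is the edge, $L$ the transverse line at $p$). A line $\ell$ through $p$ is reflected into the line $\ell'$ through $p$ if $(\ell,\ell',L,T)$ is harmonic, i.e. has cross-ratio $-1$ (the cross-ratio of four lines through $p$ is the cross-ratio of their intersection points with any fifth line not passing through $p$). Equivalently, $\ell\mapsto \ell'$ is the non-trivial projective involution of the pencil of lines through $p$ fixing $L$ and $T$ (so $L$ and $T$ are reflected into themselves). Polygonal projective billiard: a polygon with vertices $P_0,\dots,P_{n-1}$ (indices modulo $n$), whose edges are the whole lines $\gamma_k=P_kP_{k+1}$, each edge being endowed with a field of transverse lines $M\mapsto L_k(M)\ni M$ for $M\in\gamma_k$. Orbit: for distinct points $M_0\in P_0P_1$, $M_1\in P_1P_2$, the orbit of $(M_0,M_1)$ is the sequence $(M_k)_{k\in\mathbb{Z}}$ with $M_k\in P_kP_{k+1}$ (indices of $P$ modulo $n$) such that for each $k$ the line $M_{k-1}M_k$ is reflected into the line $M_kM_{k+1}$ by the projective reflection law at $M_k$ with edge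 $\gamma_k$ and transverse line $L_k(M_k)$. Obstacles between consecutive edges are ignored. For $m$ a positive multiple of $n$, the orbit is $m$-periodic if the lines $M_mM_{m+1}$ and $M_0M_1$ coincide. The billiard is $m$-reflective if there is a non-empty open subset $U\times V\subset P_0P_1\times P_1P_2$ such that the orbit of every $(M_0,M_1)\in U\times V$ is $m$-periodic. Centrally-projective polygon $\mathrm{CPol}(O;P_0,\dots,P_{n-1})$: the polygonal projective billiard on $P_0\cdots P_{n-1}$ in which the transverse line at $M\in\gamma_i=P_iP_{i+1}$ is $L_i(M)=MO$, the line joining $M$ to the point $O$ (the origin). *)

(* Defs.v *)
From HB Require Import structures.
From mathcomp Require Import all_boot all_order all_algebra.
From mathcomp Require Import all_classical all_reals.
From mathcomp Require Import topology normedtype.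

Set Implicit Arguments.
Unset Strict Implicit.
Unset Printing Implicit Defensive.

Import Order.TTheory GRing.Theory Num.Theory.
Import numFieldNormedType.Exports.

Local Open Scope quotient_scope.
Local Open Scope classical_set_scope.
Local Open Scope ring_scope.

Section ProjectivePlane.
Variable R : realType.

Definition nonzero_vector : Type := [set v : 'rV[R]_3 | v != 0].
HB.instance Definition _ := Topological.copy nonzero_vector
  ([set v : 'rV[R]_3 | v != 0] : topologicalType).

(* Two nonzero vectors are proportional iff they span the same row space. *)
Definition proportional (u v : nonzero_vector) : bool :=
  (\val u == \val v)%MS.

Lemma proportional_refl : reflexive proportional.
Proof. by move=> u; rewrite /proportional submx_refl. Qed.

Lemma proportional_sym : symmetric proportional.
Proof. by move=> u v; rewrite /proportional andbC. Qed.

Lemma proportional_trans : transitive proportional.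
Proof.
move=> v u w /andP[uv vu] /andP[vw wv].
by rewrite /proportional (submx_trans uv vw) (submx_trans wv vu).
Qed.

Canonical proportional_equiv :=
  EquivRel proportional proportional_refl proportional_sym proportional_trans.

(* The real projective plane, with the quotient topology coming from the
   space of nonzero vectors. *)
Definition RP2 : Type := quotient_topology {eq_quot proportional}.
HB.instance Definition _ := Topological.on RP2.
HB.instance Definition _ := Quotient.on RP2.

(* A choice of homogeneous coordinates. *)
Definition hcoord (X : RP2) : 'rV[R]_3 := \val (repr X : nonzero_vector).

(* This is the line AB only when A <> B; line A A is the point A. *)
Definition line (A B : RP2) : set RP2 :=
  [set X | (hcoord X <= hcoord A + hcoord B)%MS].

Definition is_line (l : set RP2) : Prop :=
  exists A B, A <> B /\ l = line A B.

Definition collinear (A B C : RP2) : Prop :=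
  exists l, [/\ is_line l, l A, l B & l C].

Definition bracket (x y : 'rV[R]_2) : R :=
  x 0 0 * y 0 1 - x 0 1 * y 0 0.

(* The cross-ratio (A, B, C, D) of four points of a line is r: the rows of F
   span the line, and a, b, c, d are homogeneous coordinates of the points on
   the line in that basis; for affine coordinates, r is
   ((a - c) (b - d)) / ((a - d) (b - c)).
   Since x / 0 = 0, the finite nonzero values of r are only taken in the
   genuine (nondegenerate) cases. *)
Definition cross_ratio (A B C D : RP2) (r : R) : Prop :=
  exists (F : 'M[R]_(2, 3)) (a b c d : 'rV[R]_2),
    [/\ row_free F,
        [/\ hcoord A = a *m F, hcoord B = b *m F,
            hcoord C = c *m F & hcoord D = d *m F] &
        r = (bracket a c * bracket b d) / (bracket a d * bracket b c)].

(* The cross-ratio of four lines through p, read on a fifth line m that does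
   not pass through p (the value does not depend on m). *)
Definition lines_cross_ratio (p : RP2) (l1 l2 l3 l4 : set RP2) (r : R) : Prop :=
  exists (m : set RP2) (A B C D : RP2),
    [/\ is_line m, ~ m p,
        [/\ (l1 `&` m) A, (l2 `&` m) B, (l3 `&` m) C & (l4 `&` m) D] &
        cross_ratio A B C D r].

(* The line l through p is reflected into l', for the edge T and the
   transverse line L at p. When l is L or T the cross-ratio (l, l', L, T) is
   not defined for l' = l; the involution fixes these two lines. *)
Definition reflected (p : RP2) (T L l l' : set RP2) : Prop :=
  [/\ [/\ is_line T, is_line L, is_line l & is_line l'],
      [/\ T p, L p, l p & l' p],
      T <> L &
      lines_cross_ratio p l l' L T (- 1) \/ (l' = l /\ (l = L \/ l = T))].

End ProjectivePlane.

Section Billiard.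
Variables (R : realType) (n : nat).

(* For 1 < n, 'Z_n is the ring of integers modulo n, so that "i + 1" is the
   next index in the cyclic order. *)
Record billiard := Billiard {
  vertex : 'Z_n -> RP2 R;
  transverse : 'Z_n -> RP2 R -> set (RP2 R)
}.

Definition edge (P : 'Z_n -> RP2 R) (i : 'Z_n) : set (RP2 R) :=
  line (P i) (P (i + 1)).

Definition is_orbit (B : billiard) (M0 M1 : RP2 R) (M : int -> RP2 R) : Prop :=
  [/\ M 0 = M0, M 1 = M1,
      (forall k : int, edge (vertex B) k%:~R (M k)),
      (forall k : int, M k <> M (k + 1)) &
      (forall k : int,
         reflected (M k) (edge (vertex B) k%:~R) (transverse B k%:~R (M k))
           (line (M (k - 1)) (M k)) (line (M k) (M (k + 1))))].

Definition periodic (m : nat) (M : int -> RP2 R) : Prop :=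
  line (M m%:Z) (M (m%:Z + 1)) = line (M 0) (M 1).

Definition open_in (A U : set (RP2 R)) : Prop :=
  exists W : set (RP2 R), open W /\ U = W `&` A.

(* The orbit is required to exist and to be unique, which makes "the orbit of
   (M0, M1)" meaningful: it breaks down if, for instance, some M k happens to
   be a vertex. *)
Definition reflective (m : nat) (B : billiard) : Prop :=
  [/\ (0 < m)%N, (n %| m)%N &
      exists U V : set (RP2 R),
        [/\ open_in (edge (vertex B) 0) U, U !=set0,
            open_in (edge (vertex B) 1) V, V !=set0 &
            forall M0 M1, U M0 -> V M1 ->
              exists M, unique (is_orbit B M0 M1) M /\ periodic m M]].

Definition CPol (O : RP2 R) (P : 'Z_n -> RP2 R) : billiard :=
  Billiard P (fun _ M => line M O).

End Billiard.

(* Main.v *)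
(* A line is the kernel of a covector.  The reflection at a point M of an edge,
   with transverse line MO, is induced by the harmonic homology with center O
   whose axis is that edge; this homology does not depend on M.  On covectors,
   with f the equation of the edge normalized by f(O) = 1, it reads
   c |-> c - 2 c(O) f, so the value at O changes sign at each reflection and k
   reflections give c - 2 c(O) (f_1 - f_2 + ... +- f_k).  For n odd the
   alternating sum over two turns vanishes, so every line comes back after 2n
   reflections.  The orbit exists and is unique as soon as the k-th line avoids
   the vertex P_(k+1) for the 2n values of k, which is a nonempty open condition
   on the first line. *)
Require Import Defs.
From mathcomp Require Import all_boot all_order all_algebra.
From mathcomp Require Import all_classical all_reals.
From mathcomp Require Import topology normedtype ring zify.

Set Implicit Arguments.
Unset Strict Implicit.
Unset Printing Implicit Defensive.

Import Order.TTheory GRing.Theory Num.Theory.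
Import numFieldNormedType.Exports.

Local Open Scope quotient_scope.
Local Open Scope classical_set_scope.
Local Open Scope ring_scope.

(** * Projective duality: lines as zero sets of covectors *)

Section Duality.
Variable R : realType.
Implicit Types (X Y A B : RP2 R) (x y : 'rV[R]_3) (c f : 'cV[R]_3).
Implicit Types l : set (RP2 R).

Definition dot x c : R := (x *m c) 0 0.

Lemma dotDl x y c : dot (x + y) c = dot x c + dot y c.
Proof. by rewrite /dot mulmxDl mxE. Qed.

Lemma dotNl x c : dot (- x) c = - dot x c.
Proof. by rewrite /dot mulNmx mxE. Qed.

Lemma dotZl a x c : dot (a *: x) c = a * dot x c.
Proof. by rewrite /dot -scalemxAl mxE. Qed.

Lemma dotDr x c f : dot x (c + f) = dot x c + dot x f.
Proof. by rewrite /dot mulmxDr mxE. Qed.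

Lemma dotBr x c f : dot x (c - f) = dot x c - dot x f.
Proof. by rewrite /dot mulmxBr !mxE. Qed.

Lemma dotZr a x c : dot x (a *: c) = a * dot x c.
Proof. by rewrite /dot -scalemxAr mxE. Qed.

Lemma dot0r x : dot x 0 = 0.
Proof. by rewrite /dot mulmx0 mxE. Qed.

Lemma dot0l c : dot 0 c = 0.
Proof. by rewrite /dot mul0mx mxE. Qed.

Lemma dot_eq0 x c : dot x c = 0 -> x *m c = 0.
Proof. by move=> xc; apply/matrixP => i j; rewrite !ord1 [LHS]xc mxE. Qed.

Definition zeros c : set (RP2 R) := [set X | dot (hcoord X) c = 0].

Lemma hcoord_neq0 X : hcoord X != 0.
Proof. by have := valP (repr X : nonzero_vector R); rewrite inE. Qed.

Lemma hcoord_pi (v : nonzero_vector R) :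
  exists2 k : R, k != 0 & hcoord (\pi_(RP2 R) v) = k *: \val v.
Proof.
have : proportional (repr (\pi_(RP2 R) v)) v.
  by apply/eqmodP; rewrite reprK.
case/andP=> /sub_rVP[k hk] _; exists k => //.
apply: contra_neq (hcoord_neq0 (\pi_(RP2 R) v)) => k0.
by rewrite /hcoord hk k0 scale0r.
Qed.

Lemma exists_point x : x != 0 ->
  exists (X : RP2 R), exists2 k : R, k != 0 & hcoord X = k *: x.
Proof.
move=> x0; have xP : x \in [set v : 'rV[R]_3 | v != 0] by rewrite inE.
pose v : nonzero_vector R := exist _ x xP.
by exists (\pi_(RP2 R) v); exact: hcoord_pi.
Qed.

Lemma hcoord_inj X Y : (hcoord X <= hcoord Y)%MS -> X = Y.
Proof.
move=> XY; rewrite -[X]reprK -[Y]reprK; apply/eqmodP/andP; split => //.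
case/sub_rVP: XY => k hk.
have k0 : k != 0.
  by apply: contra_neq (hcoord_neq0 X) => k0; rewrite hk k0 scale0r.
by apply/sub_rVP; exists k^-1; rewrite [\val (repr X)]hk scalerK.
Qed.

Lemma rank_join A B : A <> B -> \rank (hcoord A + hcoord B)%MS = 2.
Proof.
move=> AB; apply/eqP; rewrite eqn_leq; apply/andP; split.
  by rewrite (leq_trans (mxrank_adds_leqif _ _)) // !rank_rV !hcoord_neq0.
rewrite ltnNge; apply/negP => r1; apply: AB; apply: hcoord_inj.
suff : (hcoord A + hcoord B <= hcoord B)%MS.
  by apply: submx_trans; exact: addsmxSl.
rewrite -(geq_leqif (mxrank_leqif_sup (addsmxSr (hcoord A) _))).
by rewrite (leq_trans r1) // rank_rV hcoord_neq0.
Qed.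

Lemma rank_cV c : c != 0 -> \rank c = 1%N.
Proof. by move=> c0; rewrite -mxrank_tr rank_rV trmx_eq0 c0. Qed.

(** The span of two distinct points and the kernel of a nonzero covector both have dimension 2, so
    one inclusion gives equality. *)
Lemma line_zeros A B c : A <> B -> c != 0 -> zeros c A -> zeros c B ->
  line A B = zeros c.
Proof.
move=> AB c0 cA cB.
have sub : (hcoord A + hcoord B <= kermx c)%MS.
  by rewrite addsmx_sub; apply/andP; split; apply/sub_kermxP/dot_eq0.
have eqk : (kermx c <= hcoord A + hcoord B)%MS.
  by rewrite -(geq_leqif (mxrank_leqif_sup sub)) rank_join // mxrank_ker
    rank_cV.
apply/seteqP; split => X /=.
  by move/submx_trans/(_ sub)/sub_kermxP => Xc; rewrite /zeros /dot /= Xc mxE.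
by move/dot_eq0/sub_kermxP/submx_trans; apply.
Qed.

Lemma line_l A B : line A B A.
Proof. exact: addsmxSl. Qed.

Lemma line_r A B : line A B B.
Proof. exact: addsmxSr. Qed.

Lemma annihilator_neq0 m (V : 'M[R]_(m, 3)) : (\rank V < 3)%N ->
  exists2 c : 'cV[R]_3, c != 0 & V *m c = 0.
Proof.
move=> rV.
have : kermx V^T != 0.
  by rewrite -mxrank_eq0 mxrank_ker mxrank_tr subn_eq0 -ltnNge.
case/rowV0Pn => v /sub_kermxP vV v0; exists v^T; first by rewrite trmx_eq0.
by rewrite -[V]trmxK -trmx_mul vV trmx0.
Qed.

Lemma is_line_zeros l : is_line l -> exists2 c, c != 0 & l = zeros c.
Proof.
case=> A [B [AB ->]].
have [|c c0 hc] := @annihilator_neq0 _ (hcoord A + hcoord B)%MS.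
  by rewrite rank_join.
exists c => //; apply: line_zeros => //; rewrite /zeros /dot /=.
- have /submxP[D ->] := addsmxSl (hcoord A) (hcoord B).
  by rewrite -mulmxA hc mulmx0 mxE.
have /submxP[D ->] := addsmxSr (hcoord A) (hcoord B).
by rewrite -mulmxA hc mulmx0 mxE.
Qed.

Lemma zeros_is_line c : c != 0 -> is_line (zeros c).
Proof.
move=> c0.
have : \rank (kermx c) = 2 by rewrite mxrank_ker rank_cV.
have := row_base_free (kermx c); have := eq_row_base (kermx c).
move: (row_base (kermx c)) => K eqK freeK rk; move: K eqK freeK.
rewrite rk => K eqK freeK.
have rowK i : dot (row i K) c = 0.
  rewrite /dot; suff -> : row i K *m c = 0 by rewrite mxE.
  by apply/sub_kermxP; rewrite -eqK row_sub.
have row0 i : row i K != 0.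
  rewrite rowE; apply/eqP => /(congr1 (mulmx^~ (pinvmx K))).
  rewrite mulmxKp // mul0mx => /matrixP/(_ 0 i)/eqP.
  by rewrite !mxE !eqxx oner_eq0.
have [A [a a0 hA]] := exists_point (row0 0).
have [B [b b0 hB]] := exists_point (row0 1).
have AB : A <> B.
  move=> eqAB; have : a *: row 0 K = b *: row 1 K by rewrite -hA -hB eqAB.
  rewrite !rowE !scalemxAl => /(congr1 (mulmx^~ (pinvmx K))).
  rewrite !mulmxKp // => /matrixP/(_ 0 0)/eqP.
  by rewrite !mxE /= mulr1 mulr0 (negPf a0).
exists A, B; split => //; rewrite (line_zeros AB c0) // /zeros /=.
  by rewrite hA dotZl rowK mulr0.
by rewrite hB dotZl rowK mulr0.
Qed.

Lemma zeros_meet c f X Y : c != 0 -> f != 0 -> zeros c <> zeros f ->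
  zeros c X -> zeros f X -> zeros c Y -> zeros f Y -> X = Y.
Proof.
move=> c0 f0 cf cX fX cY fY; apply: contrapT => XY; apply: cf.
by rewrite -(line_zeros XY c0 cX cY) (line_zeros XY f0 fX fY).
Qed.

Lemma exists_meet c f : exists X, zeros c X /\ zeros f X.
Proof.
have : kermx (row_mx c f) != 0.
  rewrite -mxrank_eq0 mxrank_ker subn_eq0 -ltnNge.
  exact: leq_ltn_trans (rank_leq_col _) _.
case/rowV0Pn => v /sub_kermxP; rewrite mul_mx_row -row_mx0 => /eq_row_mx[vc vf].
move=> /exists_point[X [k _ XE]]; exists X.
by rewrite /zeros /= XE !dotZl /dot vc vf !mxE mulr0.
Qed.

End Duality.

(** * The reflection law as a harmonic homology *)

Section Reflection.
Variable R : realType.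
Implicit Types (x y o : 'rV[R]_3) (c f : 'cV[R]_3).

(* Transpose of the harmonic homology x |-> x - 2 (x f) o with center o and
   axis the kernel of f. *)
Definition homology o f c : 'cV[R]_3 := c - (2 * dot o c) *: f.

Lemma dot_homology o f c x :
  dot x (homology o f c) = dot x c - 2 * dot o c * dot x f.
Proof. by rewrite dotBr dotZr. Qed.

Lemma homologyK o f : dot o f = 1 -> involutive (homology o f).
Proof.
move=> of1 c; rewrite {1}/homology dot_homology of1 mulr1.
rewrite (_ : 2 * (dot o c - 2 * dot o c) = - (2 * dot o c)); last by ring.
by rewrite scaleNr opprK subrK.
Qed.

Lemma homology_neq0 o f c : dot o f = 1 -> c != 0 -> homology o f c != 0.
Proof.
move=> of1; apply: contra_neq => h0; rewrite -[c](homologyK of1) h0.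
by rewrite /homology dot0r mulr0 scale0r subr0.
Qed.

(** Since [x / 0 = 0], the value [- 1] forces a nonzero denominator, and the relation can be cleared
    of fractions. *)
Lemma cross_ratio_neg1 (a b c d : 'rV[R]_2) :
  - 1 = (bracket a c * bracket b d) / (bracket a d * bracket b c) ->
  bracket a c * bracket b d != 0 /\
  bracket a c * bracket b d = - (bracket a d * bracket b c).
Proof.
set u := bracket a c * _; set v := bracket a d * _ => uv.
have v0 : v != 0.
  apply/eqP => v0; move: uv; rewrite v0 invr0 mulr0 => /eqP.
  by rewrite oppr_eq0 oner_eq0.
have uE : u = - v by rewrite -[u](divfK v0) -uv mulN1r.
by rewrite uE oppr_eq0.
Qed.

Lemma mulmx_rV2 (v : 'rV[R]_2) (w : 'cV[R]_2) :
  (v *m w) 0 0 = v 0 0 * w 0 0 + v 0 1 * w 1 0.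
Proof.
rewrite mxE 2!big_ord_recl big_ord0 addr0.
by congr (_ + v 0 _ * w _ 0); exact/val_inj.
Qed.

(** As [g] vanishes at [a], its values at [b], [c] are in the ratio of the brackets ab, ac; likewise
    those of [h] are in the ratio of bd, cd. Harmonicity fixes the resulting quotient to 2. *)
Lemma harmonic_forms (a b c d : 'rV[R]_2) (g h : 'cV[R]_2) :
  - 1 = (bracket a c * bracket b d) / (bracket a d * bracket b c) ->
  (a *m g) 0 0 = 0 -> (d *m h) 0 0 = 0 ->
  (b *m g) 0 0 * (c *m h) 0 0 = 2 * (c *m g) 0 0 * (b *m h) 0 0.
Proof.
case/cross_ratio_neg1 => /mulfI mulI E.
rewrite !mulmx_rV2 => ag dh; apply: mulI.
move: ag dh E; rewrite /bracket.
move: (a _ _) (a _ 1) (b _ _) (b _ 1) (c _ _) (c _ 1) (d _ _) (d _ 1)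
  (g _ _) (g 1 _) (h _ _) (h 1 _).
move=> a0 a1 b0 b1 c0 c1 d0 d1 g0 g1 h0 h1 ag dh E.
have bg : (b0 * g0 + b1 * g1) * (a0 * c1 - a1 * c0) =
          (c0 * g0 + c1 * g1) * (a0 * b1 - a1 * b0).
  apply/eqP; rewrite -subr_eq0 -[0](mul0r (b0 * c1 - b1 * c0)) -ag.
  by apply/eqP; ring.
have ch : (c0 * h0 + c1 * h1) * (b0 * d1 - b1 * d0) =
          (b0 * h0 + b1 * h1) * (c0 * d1 - c1 * d0).
  apply/eqP; rewrite -subr_eq0 -[0](mul0r (b0 * c1 - b1 * c0)) -dh.
  by apply/eqP; ring.
(* Plucker relation (ab)(cd) = (ac)(bd) - (ad)(bc), where harmonicity makes (ad)(bc) equal to -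
   (ac)(bd). *)
have pl : (a0 * b1 - a1 * b0) * (c0 * d1 - c1 * d0) =
    2 * ((a0 * c1 - a1 * c0) * (b0 * d1 - b1 * d0)).
  move/eqP: E; rewrite -addr_eq0 => /eqP E; apply/eqP.
  by rewrite -subr_eq0 -oppr_eq0 -[X in _ == X]E; apply/eqP; ring.
rewrite mulrACA [X in X * _]mulrC bg [X in _ * X]mulrC ch mulrACA pl; ring.
Qed.

(** Away from the two fixed lines, [l'] is determined by [p] and its point [B] on the fifth line, so
    it suffices that the new covector vanishes at [B]. There [harmonic_forms] applies to [c], zero
    at [A], and to [f], zero at [D]. *)
Lemma reflected_homology (p O : RP2 R) (T L l l' : set (RP2 R)) f c :
  dot (hcoord O) f = 1 -> T = zeros f -> L O -> l = zeros c -> c != 0 ->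
  reflected p T L l l' -> l' = zeros (homology (hcoord O) f c).
Proof.
move=> of1 TE LO lE c0 [[_ lineL linel linel'] [Tp Lp lp l'p] TL H].
have pO : p <> O.
  by move=> pO; move: Tp; rewrite TE pO /zeros /= of1 => /eqP; rewrite oner_eq0.
have r0 := homology_neq0 of1 c0.
(* The fixed lines come first: on [L] the value c(O) is zero, and on [T] both [c] and [f] vanish, so
   the correction term does not change the line. *)
case: H => [[m [A [B [C [D [linem mp HABCD cr]]]]]]|]; last first.
  case=> -> [lL|lT].
    suff -> : homology (hcoord O) f c = c by [].
    have : l O by rewrite lL.
    by rewrite lE /zeros /homology /= => ->; rewrite mulr0 scale0r subr0.
  move: linel lE lT TE => [X [Y [XY ->]]] lE lT TE.
  have := line_l X Y; have := line_r X Y.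
  rewrite lE /zeros /= => Yc Xc; rewrite -[RHS](line_zeros XY r0) ?lE //.
    have := line_l X Y; rewrite lT TE /zeros /= => Xf.
    by rewrite dot_homology Xc Xf mulr0 subr0.
  have := line_r X Y; rewrite lT TE /zeros /= => Yf.
  by rewrite dot_homology Yc Yf mulr0 subr0.
case: HABCD => -[lA mA] [l'B mB] [LC mC] [TD mD].
have [e e0 l'E] := is_line_zeros linel'.
have pB : p <> B by move=> pB; apply: mp; rewrite pB.
have pC : p <> C by move=> pC; apply: mp; rewrite pC.
suff rB : zeros (homology (hcoord O) f c) B.
  rewrite l'E in l'p l'B *; rewrite -(line_zeros pB e0) //.
  rewrite -(line_zeros pB r0) //.
  move: lp Tp; rewrite lE TE /zeros /= dot_homology => -> ->.
  by rewrite mulr0 subr0.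
have [g g0 LE] := is_line_zeros lineL.
(* As [O] lies on [L], it is a combination u p + v C, and f(O) = 1 becomes v f(C) = 1. *)
have : line p C O by rewrite (line_zeros pC g0) -?LE.
case/sub_addsmxP => -[u v] /=.
rewrite [u]mx11_scalar [v]mx11_scalar !mul_scalar_mx.
move: (u 0 0) (v 0 0) => {}u {}v oE.
case: cr => F [a [b [cc [d [_ [hA hB hC hD] hr]]]]].
have dF (w : 'rV_2) (k : 'cV_3) : dot (w *m F) k = (w *m (F *m k)) 0 0.
  by rewrite /dot mulmxA.
have := @harmonic_forms a b cc d (F *m c) (F *m f) hr.
move: lp Tp lA TD of1; rewrite lE TE /zeros /= => pc pf lA TD.
rewrite -!dF -hA -hB -hC -hD lA TD oE !dotDl !dotZl pf mulr0 add0r.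
move=> vC /(_ erefl erefl) H.
rewrite dot_homology dotDl !dotZl pc mulr0 add0r.
have -> : dot (hcoord B) c = v * (dot (hcoord B) c * dot (hcoord C) f).
  by rewrite mulrCA vC mulr1.
rewrite H; ring.
Qed.

(** Exchanging the first two lines inverts the cross-ratio, and [- 1] is its own inverse. This
    serves for the backward half of the orbit. *)
Lemma reflected_sym (p : RP2 R) (T L l l' : set (RP2 R)) :
  reflected p T L l l' -> reflected p T L l' l.
Proof.
case=> -[lT lL ll ll'] [Tp Lp lp l'p] TL H; split => //.
case: H => [|[-> H]]; last by right.
case=> m [A [B [C [D [lm mp [HA HB HC HD]]]]]].
case=> F [a [b [c [d [freeF [hA hB hC hD] hr]]]]].
left; exists m, B, A, C, D; split => //; exists F, b, a, c, d; split => //.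
rewrite -[LHS]invrK invrN1 hr invf_div; congr (_ / _); exact: mulrC.
Qed.

(** The auxiliary point [X] provides the fifth line OX, on which the four points can be written
    explicitly. *)
Lemma homology_reflected (p O X : RP2 R) f c :
  dot (hcoord O) f = 1 -> zeros f p -> zeros c p -> zeros f X -> ~ zeros c X ->
  reflected p (zeros f) (line p O) (zeros c) (zeros (homology (hcoord O) f c)).
Proof.
move=> of1 fp cp fX cX; set o := hcoord O.
have pO : p <> O.
  by move=> pO; move: fp; rewrite pO /zeros /= of1 => /eqP; rewrite oner_eq0.
have f0 : f != 0.
  by apply: contra_eq_neq of1 => ->; rewrite dot0r eq_sym oner_neq0.
have c0 : c != 0 by apply: contra_notN cX => /eqP ->; exact: dot0r.
have r0 : homology o f c != 0 by exact: homology_neq0.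
have OX : O <> X.
  by move=> OX; move: fX; rewrite -OX /zeros /= of1 => /eqP; rewrite oner_eq0.
have pX : p <> X by move=> pX; apply: cX; rewrite -pX.
split.
- split; [exact: zeros_is_line|by exists p, O| |]; exact: zeros_is_line.
- split => //; first exact: line_l.
  by move: fp cp; rewrite /zeros /= dot_homology => -> ->; rewrite mulr0 subr0.
- move=> fL; have : zeros f O by rewrite fL; exact: line_r.
  by rewrite /zeros /= of1 => /eqP; rewrite oner_eq0.
(* If c(O) = 0 the line is the transverse line, covered by the degenerate clause of the law. *)
have [oc0|oc0] := eqVneq (dot o c) 0.
  right; split; first by rewrite /homology oc0 mulr0 scale0r subr0.
  by left; rewrite (line_zeros pO c0).
left; set x := hcoord X.
have xc0 : dot x c != 0 by exact/eqP.
have xf : dot x f = 0 by [].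
have free2 (u v : R) : u *: o + v *: x = 0 -> u = 0 /\ v = 0.
  move=> E; have := congr1 (fun y => dot y c) E.
  have := congr1 (fun y => dot y f) E.
  rewrite /= !dotDl !dotZl of1 xf mulr1 mulr0 addr0 !dot0l => ->.
  by rewrite mul0r add0r => /eqP; rewrite mulf_eq0 (negPf xc0) orbF => /eqP.
(* OX meets the zeros of [c] at c(x) o - c(o) x, whose harmonic conjugate with respect to O and X is
   c(x) o + c(o) x. *)
have [|A [ka ka0 hA]] := @exists_point R (dot x c *: o - dot o c *: x).
  by apply: contra_neq xc0; rewrite -scaleNr => /free2[].
have [|B [kb kb0 hB]] := @exists_point R (dot x c *: o + dot o c *: x).
  by apply: contra_neq xc0 => /free2[].
exists (line O X), A, B, O, X; split.
- by exists O, X.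
- case/sub_addsmxP => -[u v] /=.
  rewrite [u]mx11_scalar [v]mx11_scalar !mul_scalar_mx.
  move: (u 0 0) (v 0 0) => {}u {}v pE.
  have u0 : u = 0.
    by move: fp; rewrite /zeros /= pE dotDl !dotZl of1 -/x xf mulr0 addr0 mulr1.
  by apply/pX/hcoord_inj; rewrite pE u0 scale0r add0r scalemx_sub.
- have onOX (Y : RP2 R) (u v : R) : hcoord Y = u *: o + v *: x -> line O X Y.
    by move=> hY; rewrite /line /= hY addmx_sub_adds // scalemx_sub.
  split; split; rewrite /zeros /=.
  + by rewrite hA dotZl dotDl dotNl !dotZl; ring.
  + apply: (onOX _ (ka * dot x c) (- (ka * dot o c))).
    by rewrite hA scalerBr scaleNr !scalerA.
  + by rewrite hB dot_homology !(dotZl,dotDl) of1 -/x xf -/o; ring.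
  + apply: (onOX _ (kb * dot x c) (kb * dot o c)).
    by rewrite hB scalerDr !scalerA.
  + exact: line_r.
  + exact: line_l.
  + by [].
  + exact: line_r.
have mulF (u v : R) : row_mx u%:M v%:M *m col_mx o x = u *: o + v *: x.
  by rewrite mul_row_col !mul_scalar_mx.
exists (col_mx o x).
exists (row_mx (ka * dot x c)%:M (- (ka * dot o c))%:M).
exists (row_mx (kb * dot x c)%:M (kb * dot o c)%:M).
exists (row_mx 1%:M 0%:M), (row_mx 0%:M 1%:M); split.
- apply: (@inj_row_free _ (1 + 1)) => w; rewrite -[w]hsubmxK.
  rewrite [lsubmx w]mx11_scalar [rsubmx w]mx11_scalar mulF.
  by case/free2 => -> ->; rewrite raddf0 row_mx0.
- split; rewrite mulF -/o -/x.
  + by rewrite hA scalerBr scaleNr !scalerA.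
  + by rewrite hB scalerDr !scalerA.
  + by rewrite scale1r scale0r addr0.
  + by rewrite scale1r scale0r add0r.
have row0 (u v : R) :
    (row_mx u%:M v%:M : 'rV_(1 + 1)) 0 (lshift 1 (0 : 'I_1)) = u.
  by rewrite row_mxEl mxE.
have row1 (u v : R) :
    (row_mx u%:M v%:M : 'rV_(1 + 1)) 0 (rshift 1 (0 : 'I_1)) = v.
  by rewrite row_mxEr mxE.
have e0 : (0 : 'I_2) = lshift 1 (0 : 'I_1) by exact/val_inj.
have e1 : (1 : 'I_2) = rshift 1 (0 : 'I_1) by exact/val_inj.
rewrite /bracket e0 e1 !row0 !row1.
by field; rewrite ?oc0 ?xc0 ?ka0 ?kb0.
Qed.

End Reflection.

(** * Generic lines and open sets of the projective plane *)

Section Generic.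
Variable R : realType.

Lemma exists_nonroot (p : {poly R}) : p != 0 -> exists x, ~~ root p x.
Proof.
move=> p0; pose rs : seq R := [seq i%:R | i <- iota 0 (size p)].
have [/(max_poly_roots p0)|/allPn[x _ xp]] := boolP (all (root p) rs).
  rewrite map_inj_uniq ?iota_uniq; last exact: (mulrIn (oner_neq0 R)).
  by rewrite size_map size_iota ltnn => /(_ isT).
by exists x.
Qed.

(** Each condition says that the line with covector (- s', 1, - t') avoids the point (al, be, ga).
    On the curve t = s^2 it is the nonvanishing of a nonzero polynomial in s, and finitely many such
    polynomials have a common nonroot. *)
Lemma generic_parameters (I : finType) (al be ga : I -> R) :
  (forall i, ~ [/\ al i = 0, be i = 0 & ga i = 0]) ->
  exists s t e : R, 0 < e /\
    forall s' t', `|s' - s| < e -> `|t' - t| < e ->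
      forall i, - s' * al i + be i - t' * ga i != 0.
Proof.
move=> nz.
pose p i := (be i)%:P - al i *: 'X - ga i *: 'X^2.
have p0 i : p i != 0.
  apply/eqP => pi0; apply: (nz i).
  have coef k : (p i)`_k = 0 by rewrite pi0 coef0.
  move: (coef 0) (coef 1) (coef 2); rewrite /p !coefE /=.
  rewrite !mulr0 !mulr1 !subr0 !sub0r.
  by move=> -> /eqP + /eqP; rewrite !oppr_eq0 => /eqP -> /eqP ->.
have [s] : exists s, ~~ root (\prod_i p i) s.
  by apply: exists_nonroot; apply/prodf_neq0 => i _.
rewrite /root horner_prod => /prodf_neq0 ps.
pose v i := - s * al i + be i - s ^+ 2 * ga i.
have v0 i : v i != 0.
  have := ps i isT; rewrite /p.
  rewrite !(hornerD, hornerN, hornerZ, hornerC, hornerX, hornerXn).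
  apply: contra => /eqP v0; apply/eqP; rewrite -[RHS]v0 /v; ring.
(* If the form vanished at (s', t'), then |v i| would be at most the deviation times |al i| + |ga
   i|; the summand 1 makes this contradictory and keeps [w i] positive. *)
pose w i := `|al i| + `|ga i| + 1.
have w0 i : 0 < w i by rewrite ltr_wpDl // addr_ge0.
exists s, (s ^+ 2), (\big[Order.min/1]_i (`|v i| / w i)); split.
  by apply: lt_bigmin => [|i _]; rewrite ?ltr01 ?divr_gt0 ?normr_gt0.
move=> s' t' hs ht i; apply/eqP => E.
have le_e : \big[Order.min/1]_i (`|v i| / w i) <= `|v i| / w i.
  exact: bigmin_le.
move: (lt_le_trans hs le_e) (lt_le_trans ht le_e).
move=> {}hs {}ht.
have : v i = (s' - s) * al i + (t' - s ^+ 2) * ga i.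
  by rewrite -[LHS]subr0 -E /v; ring.
move=> /(congr1 Num.norm) /eqP; apply/negP; rewrite gt_eqF //.
rewrite (le_lt_trans (ler_normD _ _)) // !normrM.
have vE : `|v i| = `|v i| / w i * w i by rewrite divfK // gt_eqF.
have m0 : 0 < `|v i| / w i by rewrite divr_gt0 ?normr_gt0.
rewrite [ltRHS]vE {2}/w !mulrDr mulr1 ltr_pwDr // lerD // ler_wpM2r // ltW //.
Qed.

Lemma dot_continuous (c : 'cV[R]_3) : continuous (fun x : 'rV[R]_3 => dot x c).
Proof.
rewrite /dot; under eq_fun do rewrite mxE.
apply: continuous_big => [|i _ x]; first exact: add_continuous.
by apply: continuousM; [exact: coord_continuous|exact: cst_continuous].
Qed.

(** Homogeneity makes the sign of [g] independent of the coordinates chosen by [hcoord], so the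
    preimage among nonzero vectors is open, as the quotient topology requires. *)
Lemma open_homogeneous (g : 'rV[R]_3 -> R) : continuous g ->
  (forall k x, g (k *: x) = `|k| * g x) -> open [set X | 0 < g (hcoord X)].
Proof.
move=> gc gh; rewrite /open /= /quotient_open.
rewrite (_ : _ @^-1` _ =
  (fun v : nonzero_vector R => g (\val v)) @^-1` [set r | 0 < r]).
  apply: open_comp; last exact: open_gt.
  move=> v _; apply: continuous_comp; last exact: gc.
  exact: initial_continuous.
apply/seteqP; split => v /=; have [k k0 ->] := hcoord_pi v;
  by rewrite gh pmulr_rgt0 ?normr_gt0.
Qed.

(** This is |x1 / x0 - s| < e with the denominator cleared: both sides scale alike, and the
    inequality fails where x0 = 0. *)
Lemma open_ratio (d0 d1 : 'cV[R]_3) (s e : R) :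
  open [set X | `|dot (hcoord X) d1 - s * dot (hcoord X) d0| <
                e * `|dot (hcoord X) d0| ].
Proof.
pose g (x : 'rV[R]_3) := e * `|dot x d0| - `|dot x d1 - s * dot x d0|.
rewrite (_ : [set X | _] = [set X | 0 < g (hcoord X)]).
  apply: open_homogeneous => [x|k x]; last first.
    by rewrite /g !dotZl mulrCA -mulrBr !normrM; ring.
  have c0 := @dot_continuous d0 x; have c1 := @dot_continuous d1 x.
  apply: (cvgB (cvgM (cvg_cst e) (cvg_norm c0))).
  exact: (cvg_norm (cvgB c1 (cvgM (cvg_cst s) c0))).
by apply/seteqP; split => X /=; rewrite /g subr_gt0.
Qed.

(** The covectors are the columns of the inverse of the matrix with rows [A], [B], [C]; were it
    singular, a covector annihilating its rows would give a line through the three points. *)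
Lemma dual_basis (A B C : RP2 R) : ~ collinear A B C ->
  exists e0 e1 e2 : 'cV[R]_3,
  let a := hcoord A in let b := hcoord B in let c := hcoord C in
  [/\ [/\ dot a e0 = 1, dot a e1 = 0 & dot a e2 = 0],
      [/\ dot b e0 = 0, dot b e1 = 1 & dot b e2 = 0],
      [/\ dot c e0 = 0, dot c e1 = 0 & dot c e2 = 1] &
      forall x, x = dot x e0 *: a + dot x e1 *: b + dot x e2 *: c].
Proof.
move=> nABC.
pose p (i : 'I_3) := nth A [:: A; B; C] i.
pose V : 'M[R]_3 := \matrix_i hcoord (p i).
have rowV i : row i V = hcoord (p i) by exact: rowK.
have Vu : V \in unitmx.
  rewrite -row_free_unit; apply: contra_notT nABC; rewrite /row_free => rV.
  have [|c c0 Vc] := @annihilator_neq0 R _ V.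
    by rewrite ltn_neqAle rV rank_leq_row.
  exists (zeros c); have zr i : zeros c (p i).
    by rewrite /zeros /dot /= -rowV -row_mul Vc !mxE.
  split; [exact: zeros_is_line|exact: (zr 0)|exact: (zr 1)|exact: (zr 2)].
have dotV i j : dot (hcoord (p i)) (col j (invmx V)) = (i == j)%:R.
  by rewrite /dot -rowV -row_mul colE mulmxA mulmxV // mul1mx !mxE
    eqxx andbT.
exists (col 0 (invmx V)), (col 1 (invmx V)), (col 2 (invmx V)); split.
- by split; [exact: (dotV 0 0)|exact: (dotV 0 1)|exact: (dotV 0 2)].
- by split; [exact: (dotV 1 0)|exact: (dotV 1 1)|exact: (dotV 1 2)].
- by split; [exact: (dotV 2 0)|exact: (dotV 2 1)|exact: (dotV 2 2)].
move=> x; rewrite -[LHS](mulmxKV Vu) mulmx_sum_row 3!big_ord_recl big_ord0.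
rewrite addr0 addrA.
have xV i : (x *m invmx V) 0 i = dot x (col i (invmx V)).
  by rewrite /dot colE mulmxA -[in RHS]colE [RHS]mxE.
rewrite !rowK !xV /=.
have -> : lift ord0 ord0 = 1 :> 'I_3 by exact/val_inj.
by have -> : lift ord0 (lift ord0 ord0) = 2 :> 'I_3 by exact/val_inj.
Qed.
End Generic.

(** * Iterated reflections of a covector and their period *)

Section Unfolding.
Variables (R : realType) (n : nat) (o : 'rV[R]_3) (f : 'Z_n -> 'cV[R]_3).
Hypothesis of1 : forall i, dot o (f i) = 1.

(** The sum starts at [f 1] because the line M0M1 is first reflected in edge 1. *)
Definition alternating k : 'cV[R]_3 := \sum_(j < k) (-1) ^+ j *: f j.+1%:R.

(* Closed form of the image of the line c after reflections in the edges
   1, ..., k. *)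
Definition unfolded (c : 'cV[R]_3) k : 'cV[R]_3 :=
  c - (2 * dot o c) *: alternating k.

Lemma unfolded0 c : unfolded c 0 = c.
Proof. by rewrite /unfolded /alternating big_ord0 scaler0 subr0. Qed.

Lemma alternatingS k :
  alternating k.+1 = alternating k + (-1) ^+ k *: f k.+1%:R.
Proof. by rewrite /alternating big_ord_recr. Qed.

Lemma dot_alternating k : 1 - 2 * dot o (alternating k) = (-1) ^+ k.
Proof.
elim: k => [|k IH]; first by rewrite /alternating big_ord0 dot0r mulr0 subr0.
rewrite alternatingS dotDr dotZr of1 exprS -IH; ring.
Qed.

Lemma unfoldedS c k : unfolded c k.+1 = homology o (f k.+1%:R) (unfolded c k).
Proof.
rewrite /homology {2}/unfolded dotBr dotZr.
have -> : 2 * (dot o c - 2 * dot o c * dot o (alternating k)) =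
          2 * dot o c * (1 - 2 * dot o (alternating k)) by ring.
rewrite dot_alternating /unfolded alternatingS scalerDr scalerA opprD addrA.
by [].
Qed.

(** The terms [j] and [n + j] have the same covector, indices being modulo n, and opposite signs, n
    being odd. *)
Lemma alternating_double : (1 < n)%N -> odd n -> alternating (2 * n) = 0.
Proof.
move=> n1 n_odd; rewrite /alternating mul2n -addnn big_split_ord /=.
rewrite -big_split big1 // => j _ /=.
rewrite -addnS natrD pchar_Zp // add0r exprD -(signr_odd _ n) n_odd.
rewrite mulN1r scaleNr.
exact: addrN.
Qed.

Lemma unfolded_double c : (1 < n)%N -> odd n -> unfolded c (2 * n) = c.
Proof.
by move=> n1 n_odd; rewrite /unfolded alternating_double // scaler0 subr0.
Qed.

(** Transposition turns the condition that the k-th image avoids [x] into the nonvanishing of the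
    initial covector at a vector independent of it. *)
Lemma dot_unfolded x c k :
  dot x (unfolded c k) = dot (x - (2 * dot x (alternating k)) *: o) c.
Proof. by rewrite dotBr dotZr dotDl dotNl dotZl; ring. Qed.

(** Extends the forward images periodically to all integer indices. *)
Definition residue (k : int) : nat := `|(k %% (2 * n)%N)%Z|%N.

Lemma ltn_residue k : (0 < n)%N -> (residue k < 2 * n)%N.
Proof.
move=> n0; have := @ltz_pmod k (2 * n)%N; have := @modz_ge0 k (2 * n)%N.
rewrite /residue; lia.
Qed.

Lemma residueE k : (0 < n)%N -> exists q : int, k = q * (2 * n)%N + residue k.
Proof.
move=> n0; exists (k %/ (2 * n)%N)%Z; rewrite /residue.
have := @modz_ge0 k (2 * n)%N; rewrite {2}(divz_eq k (2 * n)%N); lia.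
Qed.

Lemma residueS k : (0 < n)%N ->
  residue (k + 1) = (residue k).+1 \/
  residue (k + 1) = 0%N /\ (residue k).+1 = (2 * n)%N.
Proof.
move=> n0.
have rE : (residue k)%:Z = (k %% (2 * n)%N)%Z.
  by rewrite gez0_abs // modz_ge0; lia.
have := ltn_residue k n0; rewrite leq_eqVlt => /orP[/eqP rk|rk]; [right|left].
  by split=> //; rewrite {1}/residue -modzDml -rE -PoszD addn1 rk modzz.
by rewrite {1}/residue -modzDml -rE -PoszD addn1 modz_small.
Qed.

Lemma residue_Zp k : (1 < n)%N -> (residue k)%:R = k%:~R :> 'Z_n.
Proof.
move=> n1; have [q kE] := @residueE k (ltnW n1).
rewrite [in RHS]kE rmorphD rmorphM /= -!pmulrn natrM pchar_Zp // !mulr0 add0r.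
by [].
Qed.

(** Where the residue wraps from 2n - 1 to 0, the closure after 2n reflections supplies the
    identity. *)
Lemma unfolded_residueS c (k : int) : (1 < n)%N -> odd n ->
  unfolded c (residue (k + 1)) =
  homology o (f (k + 1)%:~R) (unfolded c (residue k)).
Proof.
move=> n1 n_odd; rewrite intrD -(residue_Zp k n1) -[1%:~R]/(1%:R) -natrD addn1.
rewrite -unfoldedS.
have [->|[-> ->]] := residueS k (ltnW n1) => //.
by rewrite unfolded_double ?unfolded0.
Qed.

End Unfolding.

(** * Existence and uniqueness of the orbit *)

Section Orbit.
Variables (R : realType) (n : nat) (P : 'Z_n -> RP2 R) (O : RP2 R).
Variables (f : 'Z_n -> 'cV[R]_3) (c : int -> 'cV[R]_3).
Hypothesis P_noncollinear :
  forall i : 'Z_n, ~ collinear (P i) (P (i + 1)) (P (i + 2%:R)).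
Hypothesis edgeE : forall i, edge P i = zeros (f i).
Hypothesis of1 : forall i, dot (hcoord O) (f i) = 1.
Hypothesis cS : forall k : int,
  c (k + 1) = homology (hcoord O) (f (k + 1)%:~R) (c k).
Hypothesis cP : forall k : int, ~ zeros (c k) (P (k%:~R + 1)).

Let f0 i : f i != 0.
Proof.
by apply: contra_eq_neq (of1 i) => ->; rewrite dot0r eq_sym oner_neq0.
Qed.

Let c0 k : c k != 0.
Proof. by apply: contra_notN (@cP k) => /eqP ->; exact: dot0r. Qed.

Let edge_l i : zeros (f i) (P i).
Proof. by rewrite -edgeE; exact: line_l. Qed.

Let edge_r i : zeros (f i) (P (i + 1)).
Proof. by rewrite -edgeE; exact: line_r. Qed.

Let edge_neq i : zeros (f i) <> zeros (f (i + 1)).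
Proof.
move=> E; apply: (@P_noncollinear i); exists (zeros (f i)); split => //.
  exact: zeros_is_line.
by rewrite E -[2%:R]/(1 + 1) addrA.
Qed.

Let c_neq_edge (k : int) : zeros (c k) <> zeros (f k%:~R).
Proof. by move=> E; apply: (@cP k); rewrite E. Qed.

Let c_neq_next (k : int) : zeros (c k) <> zeros (f (k + 1)%:~R).
Proof. by move=> E; apply: (@cP k); rewrite E intrD. Qed.

(** The homology fixes its axis pointwise, so consecutive lines meet the edge between them at the
    same point. *)
Let cS_edge (k : int) X : zeros (f (k + 1)%:~R) X ->
  zeros (c (k + 1)) X <-> zeros (c k) X.
Proof. by rewrite cS /zeros /= dot_homology => ->; rewrite mulr0 subr0. Qed.

Let meet_c (k : int) X Y : zeros (c k) X -> zeros (f k%:~R) X ->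
  zeros (c k) Y -> zeros (f k%:~R) Y -> X = Y.
Proof. exact: zeros_meet. Qed.

(** The points are the intersections of the lines [c k] with the edges. Uniqueness holds because the
    law determines the neighbours of a pair of consecutive points in both directions. *)
Lemma unfolded_orbit (M0 M1 : RP2 R) :
  zeros (c 0) M0 -> edge P 0 M0 -> zeros (c 0) M1 -> edge P 1 M1 ->
  exists M : int -> RP2 R, unique (is_orbit (CPol O P) M0 M1) M /\
    forall k, line (M k) (M (k + 1)) = zeros (c k).
Proof.
rewrite !edgeE => cM0 fM0 cM1 fM1.
have [M MP] := choice (fun k : int => exists_meet (c k) (f k%:~R)).
have cM k : zeros (c k) (M k) := (MP k).1.
have fM k : zeros (f k%:~R) (M k) := (MP k).2.
have cMS k : zeros (c k) (M (k + 1)) by apply/(cS_edge (fM _)).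
have Mneq k : M k <> M (k + 1).
  (* A coincidence would lie on two consecutive edges, hence at their common vertex, which [c k]
     avoids. *)
  move=> E; apply: (@cP k); suff <- : M k = P (k%:~R + 1) by [].
  apply: (@zeros_meet _ (f k%:~R) (f (k + 1)%:~R)) => //.
  - by rewrite intrD; exact: edge_neq.
  - by rewrite E.
  - by rewrite intrD; exact: edge_l.
have lineM k : line (M k) (M (k + 1)) = zeros (c k) by exact: line_zeros.
have lineM' k : line (M (k - 1)) (M k) = zeros (c (k - 1)).
  by rewrite -lineM subrK.
have M0E : M 0 = M0 by apply: (@meet_c 0).
have M1E : M 1 = M1.
  by apply: (@meet_c 1) => //; rewrite -[1]add0r; apply/cS_edge; rewrite ?add0r.
have cpred k : c k = homology (hcoord O) (f k%:~R) (c (k - 1)).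
  by rewrite -[in LHS](subrK 1 k) cS subrK.
have cprev k : zeros (c (k - 1)) (M k).
  by rewrite -[M k](congr1 M (subrK 1 k)).
exists M; split => //; split.
  split => // k; first by rewrite edgeE.
  rewrite /= edgeE lineM lineM' [c k]cpred.
  (* The vertex P(k + 1) is on edge k and off [c k], hence off [c (k - 1)], so it serves as the
     auxiliary point. *)
  apply: (@homology_reflected _ _ _ (P (k%:~R + 1))) => //.
  move=> ck; apply: (@cP k).
  by rewrite -[c k](congr1 c (subrK 1 k)); apply/cS_edge; rewrite ?subrK.
move=> M' [M'0 M'1 fM' M'neq refl'].
have fM'k k : zeros (f k%:~R) (M' k) by rewrite -edgeE; exact: fM'.
suff agree k : M k = M' k /\ M (k + 1) = M' (k + 1).
  by apply/funext => k; case: (agree k).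
elim/int_rect: k => [|k [IH1 IH2]|k [IH1 IH2]].
- by rewrite add0r M0E M1E.
- have kS : (k.+1)%:Z = k%:Z + 1 by rewrite -addn1 PoszD.
  rewrite kS; split=> //; set j := k%:Z in IH1 IH2 *.
  have := refl' (j + 1); rewrite addrK -IH1 -IH2 lineM /= edgeE.
  have LO : line (M (j + 1)) O O by exact: line_r.
  move/(reflected_homology (of1 _) erefl LO erefl (c0 j)); rewrite -cS => lE.
  apply: (@meet_c (j + 1 + 1)) => //.
  by apply/cS_edge => //; rewrite -lE; exact: line_r.
(* Backwards, the symmetry of the law and the involutivity of the homology recover [c (j - 1)] from
   [c j]. *)
set j := - k%:Z in IH1 IH2.
have kS : - (k.+1)%:Z = j - 1 by rewrite -addn1 PoszD opprD.
rewrite kS subrK; split=> //.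
have := refl' j; rewrite -IH1 -IH2 lineM /= edgeE => /reflected_sym.
have LO : line (M j) O O by exact: line_r.
move/(reflected_homology (of1 _) erefl LO erefl (c0 j)).
rewrite [c j]cpred homologyK // => lE.
by apply: (@meet_c (j - 1)) => //; rewrite -lE; exact: line_l.
Qed.

End Orbit.

(** * Points of an edge with a prescribed ratio of coordinates *)

Section Points.
Variable R : realType.
Implicit Types (A B X : RP2 R) (e : 'cV[R]_3).

Lemma noncollinear_neq A B C : ~ collinear A B C -> A <> B.
Proof.
move=> /dual_basis[e0 [e1 [e2 [[A0 _ _] [B0 _ _] _ _]]]] AB.
by move: A0; rewrite AB B0 => /eqP; rewrite eq_sym oner_eq0.
Qed.

Lemma line_dot A B X e : line A B X ->
  dot (hcoord A) e = 0 -> dot (hcoord B) e = 0 -> dot (hcoord X) e = 0.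
Proof.
case/sub_addsmxP => -[u v] /= ->; rewrite [u]mx11_scalar [v]mx11_scalar.
by rewrite !mul_scalar_mx dotDl !dotZl => -> ->; rewrite !mulr0 addr0.
Qed.

Lemma ratio_nbhs (x0 x1 s r : R) :
  `|x1 - s * x0| < r * `|x0| -> x0 != 0 /\ `|x1 / x0 - s| < r.
Proof.
move=> H; have x00 : x0 != 0.
  by apply: contraTneq H => ->; rewrite normr0 !mulr0 normr_lt0.
split=> //; rewrite -(ltr_pM2r (x := `|x0|)) ?normr_gt0 // -normrM.
by rewrite mulrBl divfK.
Qed.

Lemma exists_ratio A B e0 e1 (s r : R) :
  dot (hcoord A) e0 = 1 -> dot (hcoord A) e1 = 0 ->
  dot (hcoord B) e0 = 0 -> dot (hcoord B) e1 = 1 -> 0 < r ->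
  exists X, line A B X /\
    `|dot (hcoord X) e1 - s * dot (hcoord X) e0| < r * `|dot (hcoord X) e0|.
Proof.
move=> A0 A1 B0 B1 r0.
(* The witness A + s B has coordinate ratio exactly [s]. *)
have x0 : dot (hcoord A + s *: hcoord B) e0 = 1.
  by rewrite dotDl dotZl A0 B0 mulr0 addr0.
have x1 : dot (hcoord A + s *: hcoord B) e1 = s.
  by rewrite dotDl dotZl A1 B1 mulr1 add0r.
have [|X [k k0 XE]] := @exists_point R (hcoord A + s *: hcoord B).
  by apply: contra_eq_neq x0 => ->; rewrite dot0l eq_sym oner_neq0.
exists X; split.
  by rewrite /line /= XE scalemx_sub // addmx_sub_adds // scalemx_sub.
rewrite XE !dotZl x0 x1 mulr1 [k * s]mulrC subrr normr0 mulr_gt0 //.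
by rewrite normr_gt0.
Qed.

End Points.

(** * Open sets of generic initial points and periodicity of their orbits *)

Theorem proposition1p5 (R : realType) (n : nat) (P : 'Z_n -> RP2 R)
    (O : RP2 R)
    (n_ge3 : (3 <= n)%N) (n_odd : odd n)
    (P_noncollinear :
       forall i : 'Z_n, ~ collinear (P i) (P (i + 1)) (P (i + 2%:R)))
    (O_off_edges : forall i : 'Z_n, ~ edge P i O) :
  reflective (2 * n)%N (CPol O P).
Proof.
have n1 : (1 < n)%N by exact: ltnW.
have /choice[f fP] : forall i, exists g : 'cV[R]_3,
    edge P i = zeros g /\ dot (hcoord O) g = 1.
  move=> i.
  have : is_line (edge P i).
    exists (P i), (P (i + 1)); split => //.
    exact: noncollinear_neq (P_noncollinear i).
  case/is_line_zeros => g g0 edgeE.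
  have := @O_off_edges i; rewrite edgeE => /eqP Og.
  exists ((dot (hcoord O) g)^-1 *: g); rewrite dotZr mulVf //; split=> //.
  apply/seteqP; split => X; rewrite /zeros /= dotZr => /eqP.
    by move/eqP => ->; rewrite mulr0.
  by rewrite mulf_eq0 invr_eq0 (negPf Og) => /eqP.
have edgeE i := (fP i).1; have of1 i := (fP i).2.
have P1 : (0 + 1 : 'Z_n) = 1 by rewrite add0r.
have P2 : (0 + 2%:R : 'Z_n) = 1 + 1 by rewrite add0r.
have := P_noncollinear 0; rewrite P1 P2 => /dual_basis.
move=> [e0 [e1 [e2 [[a0 a1 a2] [b0 b1 b2] [c0 c1 c2] basisE]]]].
(* By [dot_unfolded], the k-th line passes through P(k + 1) exactly when the initial covector
   vanishes at [q k]. A zero [q k] would force P(k + 1) = O, which is off edge k. *)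
pose q k : 'rV[R]_3 := hcoord (P (k%:R + 1)) -
  (2 * dot (hcoord (P (k%:R + 1))) (alternating f k)) *: hcoord O.
have q_neq0 k : q k != 0.
  rewrite subr_eq0; apply/eqP => qE; apply: (@O_off_edges k%:R).
  suff <- : P (k%:R + 1) = O by exact: line_r.
  by apply: hcoord_inj; rewrite qE scalemx_sub.
have [|s [t [r [r0 generic]]]] := @generic_parameters R 'I_(2 * n)
    (fun k => dot (q k) e0) (fun k => dot (q k) e1) (fun k => dot (q k) e2).
  move=> k [q0 q1 q2]; apply: (elimN eqP (q_neq0 k)).
  by rewrite [LHS]basisE q0 q1 q2 !scale0r !addr0.
split; [by rewrite muln_gt0; lia|exact: dvdn_mull|].
(* In the dual basis of P0, P1, P2, the line with covector e1 - s e0 - t e2 meets edge 0 where x1 /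
   x0 = s and edge 1 where x1 / x2 = t, so the two points can be moved independently. *)
exists ([set X | `|dot (hcoord X) e1 - s * dot (hcoord X) e0| <
                 r * `|dot (hcoord X) e0|] `&` edge P 0)%classic.
exists ([set X | `|dot (hcoord X) e1 - t * dot (hcoord X) e2| <
                 r * `|dot (hcoord X) e2|] `&` edge P 1)%classic.
split.
- by eexists; split; [exact: (open_ratio e0 e1 s r)|reflexivity].
- have [X [XL Xr]] := exists_ratio s a0 a1 b0 b1 r0.
  by exists X; split => //; rewrite /edge P1.
- by eexists; split; [exact: (open_ratio e2 e1 t r)|reflexivity].
- have [X [XL Xr]] := exists_ratio t c2 c1 b2 b1 r0.
  by exists X; split => //; rewrite /edge /line /= addsmxC.
move=> M0 M1 [/ratio_nbhs[x00 hs] M0e] [/ratio_nbhs[y20 ht] M1e].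
have x2 : dot (hcoord M0) e2 = 0 by apply: line_dot M0e _ _; rewrite ?P1.
have y0 : dot (hcoord M1) e0 = 0 by apply: line_dot M1e _ _.
move: hs ht; set s' := _ / _; set t' := _ / _ => hs ht.
pose g := e1 - s' *: e0 - t' *: e2.
have dot_g x : dot x g = - s' * dot x e0 + dot x e1 - t' * dot x e2.
  by rewrite !dotBr !dotZr; ring.
pose c k := unfolded (hcoord O) f g (residue n k).
have c_0 : c 0 = g by rewrite /c /residue mod0z unfolded0.
have cS k : c (k + 1) = homology (hcoord O) (f (k + 1)%:~R) (c k).
  exact: unfolded_residueS.
have cP k : ~ zeros (c k) (P (k%:~R + 1)).
  rewrite /zeros /= dot_unfolded -(residue_Zp k n1) -/(q _) dot_g.
  by apply/eqP; exact: (generic _ _ hs ht (Ordinal (ltn_residue k (ltnW n1)))).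
have [|||| M [MU lineM]] := unfolded_orbit P_noncollinear edgeE of1 cS cP
  (M0 := M0) (M1 := M1) => //.
- by rewrite c_0 /zeros /= dot_g x2 mulr0 subr0 mulNr divfK // addNr.
- by rewrite c_0 /zeros /= dot_g y0 mulr0 add0r divfK // subrr.
(* The index 2n has residue 0, so its line is the initial one. *)
exists M; split=> //; rewrite /periodic lineM -[X in line _ (M X)]add0r lineM.
by rewrite /c /residue modzz mod0z.
Qed.
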